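(* Let $\Gamma$ be an abelian group with $\Gamma=\bigcup_{n}\Gamma_n$, where $\Gamma_1\subset\Gamma_2\subset\cdots$ are finitely generated subgroups. Let $k$ be a finite field, and let $V,W$ be $k$-vector spaces with bases $(v_j)_{j\ge1}$ and $(w_j)_{j\ge1}$ respectively. Let $c\ge 0$ and suppose there exists $C=C(c)$ such that for any map $a^f:\Gamma\to\mathrm{Hom}^f(V,W)$ with $$r\big(a^f(\gamma'+\gamma'')-a^f(\gamma')-a^f(\gamma'')\big)\le c\qquad\text{for all }\gamma',\gamma''\in\Gamma$$ there exists a homomorphism $\chi^f:\Gamma\to\mathrm{Hom}^f(V,W)$ such that $r(a^f(\gamma)-\chi^f(\gamma))\le C$ for all $\gamma\in\Gamma$. Then for any map $a:\Gamma\to\mathrm{Hom}(V,W)$ with $$r\big(a(\gamma'+\gamma'')-a(\gamma')-a(\gamma'')\big)\le c\qquad\text{for all }\gamma',\gamma''\in\Gamma$$ there exists a homomorphism $\chi:\Gamma\to\mathrm{Hom}(V,W)$ such that $r(a(\gamma)-\chi(\gamma))\le C$ for all $\gamma\in\Gamma$.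
   Context: $\mathrm{Hom}(V,W)$ is the space of $k$-linear maps $V\to W$, $r(m)\in[0,\infty]$ denotes the rank of a linear map $m$, and $\mathrm{Hom}^f(V,W)\subset\mathrm{Hom}(V,W)$ is the subspace of linear maps of finite rank. *)

(* Defs.v *)
From HB Require Import structures.
From mathcomp Require Import all_boot all_order all_algebra.
From mathcomp Require Import all_classical all_reals all_analysis.

Set Implicit Arguments.
Unset Strict Implicit.
Unset Printing Implicit Defensive.

Import Order.TTheory GRing.Theory Num.Theory.
Local Open Scope classical_set_scope.
Local Open Scope ring_scope.

Definition lin_indep (k : fieldType) (V : lmodType k) (n : nat)
    (x : 'I_n -> V) : Prop :=
  forall l : 'I_n -> k, \sum_(i < n) l i *: x i = 0 -> forall i, l i = 0.

(* A basis (v_0, v_1, ...) indexed by all natural numbers; the vectors are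
   distinct by independence, so the space is infinite-dimensional. *)
Definition is_basis (k : fieldType) (V : lmodType k) (v : nat -> V) : Prop :=
  (forall n, lin_indep (fun i : 'I_n => v i)) /\
  (forall x, exists (n : nat) (l : 'I_n -> k), x = \sum_(i < n) l i *: v i).

(* The dimension of the image of m, in [0, +oo]: the supremum of the sizes of
   the linearly independent families in the image. *)
Definition rank (R : realType) (k : fieldType) (V W : lmodType k)
    (m : {linear V -> W}) : \bar R :=
  ereal_sup [set n%:R%:E | n in
    [set n : nat | exists y : 'I_n -> W,
                     (forall i, range m (y i)) /\ lin_indep y]].

(* Membership in Hom^f(V, W). *)
Definition finite_rank (R : realType) (k : fieldType) (V W : lmodType k)
    (m : {linear V -> W}) : Prop := (rank R m < +oo)%E.

Definition subgroup (G : zmodType) (A : set G) : Prop :=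
  A 0 /\ (forall x y, A x -> A y -> A (x - y)).

(* [smallest (@subgroup G) S] is the subgroup generated by S. *)
Definition fg_subgroup (G : zmodType) (A : set G) : Prop :=
  subgroup A /\
  exists S : set G, finite_set S /\ A = smallest (@subgroup G) S.

(* Homomorphisms from G to the additive group Hom(V, W), whose addition is
   pointwise. *)
Definition is_hom (k : fieldType) (V W : lmodType k) (G : zmodType)
    (chi : G -> {linear V -> W}) : Prop :=
  forall x y : G, chi (x + y) =1 chi x \+ chi y.

(* Main.v *)
Require Import Defs.
From HB Require Import structures.
From mathcomp Require Import all_boot all_order all_algebra.
From mathcomp Require Import all_classical all_reals all_analysis.

Import Order.TTheory GRing.Theory Num.Theory.
Local Open Scope classical_set_scope.
Local Open Scope ring_scope.

(** Let p_n be a projection of V onto the span of v_0, ..., v_(n-1). The map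
    a o p_n takes values of finite rank, and its defect is that of a composed
    with p_n, so the hypothesis gives homomorphisms chi_n with a o p_n - chi_n
    of rank at most C. Any vector of V is fixed by p_n for n large, so the chi_n
    only have to be glued along n.

    Gluing is done along a non-principal ultrafilter U on the integers. The
    ultrapower W^N / U is a vector space over the ultrapower of k, which is k
    itself because k is finite, and mapping g to x |-> [chi_n(g) x]_n is a
    homomorphism from G to the linear maps V -> W^N / U. Its difference with a,
    where W sits diagonally in W^N / U, still has rank at most C: since k^r is
    finite, a relation between r vectors that exists at each index n can be
    chosen to be the same for U-almost all n (ultralimit_lin_indep).

    The values of this limit need not lie in W. But W is a direct summand of
    W^N / U (linear_retraction); projecting back to W preserves additivity,
    does not move a, and can only lower the rank of the difference
    (ultralimit_rank_le). *)

(** * Retracting onto a subspace *)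

(** A maximal subspace containing [K] and meeting the image of [i] trivially is
    a complement of that image, and the projection along it is the retraction.
    [Zorn_bigcup] asks that the empty chain be bounded too, hence the property
    is required of [K `|` M] rather than of [M]. *)
Lemma linear_retraction (k : fieldType) (X W : lmodType k)
    (i : {linear W -> X}) (K : set X) :
    K 0 ->
    (forall (t : k) x y, K x -> K y -> K (t *: x + y)) ->
    (forall w, K (i w) -> w = 0) ->
  exists p : {linear X -> W},
    (forall w, p (i w) = w) /\ (forall x, K x -> p x = 0).
Proof.
move=> K0 KL Ki.
pose Q (M : set X) := (forall (t : k) x y, M x -> M y -> M (t *: x + y)) /\
  (forall w, M (i w) -> w = 0).
have [F FQ Ftot|A [[AL Ai] Amax]] := @Zorn_bigcup X (fun M => Q (K `|` M)).
  have sub M x : F M -> (K `|` M) x -> (K `|` \bigcup_(B in F) B) x.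
    by move=> FM [Kx|Mx]; [left|right; exists M].
  split=> [t x y [Kx|[B FB Bx]] [Ky|[D FD Dy]]|w [/Ki //|[B FB Bw]]].
  - by left; apply: KL.
  - by apply: (sub D) => //; apply: (FQ D FD).1; [left|right].
  - by apply: (sub B) => //; apply: (FQ B FB).1; [right|left].
  - have [BD|DB] := Ftot _ _ FB FD.
      by apply: (sub D) => //; apply: (FQ D FD).1; right=> //; apply: BD.
    by apply: (sub B) => //; apply: (FQ B FB).1; right=> //; apply: DB.
  - by apply: (FQ B FB).2; right.
set M := K `|` A in AL Ai.
have M0 : M 0 by left.
have MZ t x : M x -> M (t *: x) by move=> Mx; rewrite -[_ *: _]addr0; apply: AL.
have MB x y : M x -> M y -> M (x - y).
  by move=> Mx My; rewrite -scaleN1r addrC; apply: AL.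
have decomp x : exists w, M (x - i w).
  apply: contrapT => nx.
  pose N : set X := [set z | exists y t, M y /\ z = y + t *: x].
  have MN z : M z -> N z by move=> Mz; exists z, 0; rewrite scale0r addr0.
  have NQ : Q N.
    split=> [t _ _ [y1 [t1 [My1 ->]]] [y2 [t2 [My2 ->]]]|w [y [t [My iw]]]].
      exists (t *: y1 + y2), (t * t1 + t2); split; first exact: AL.
      by rewrite scalerDr scalerDl scalerA addrACA.
    have [t0|tn0] := eqVneq t 0.
      by apply: Ai; rewrite iw t0 scale0r addr0.
    case: nx; exists (t^-1 *: w); rewrite linearZ /= iw scalerDr scalerA.
    rewrite mulVf// scale1r opprD addrCA subrr addr0 -scaleN1r.
    exact/MZ/MZ.
  apply: (Amax N); last first.
    suff -> : K `|` N = N by [].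
    by apply: setUidr => z Kz; apply: MN; left.
  split; first by move=> z Az; apply: MN; right.
  move=> NA; apply: nx; exists 0; rewrite linear0 subr0; right; apply: NA.
  by exists 0, 1; rewrite scale1r add0r.
have [p pP] := choice decomp.
have uniq_p x w : M (x - i w) -> p x = w.
  move=> Mw; apply/eqP; rewrite -subr_eq0; apply/eqP/Ai; rewrite linearB.
  have := MB _ _ Mw (pP x); rewrite opprB addrC addrA -[_ - x + x]addrA.
  by rewrite addNr addr0.
have plin : linear p.
  move=> t x y; apply: uniq_p; rewrite linearP opprD addrACA -scalerBr.
  by apply: AL.
pose P : {linear X -> W} := HB.pack p (GRing.isLinear.Build _ _ _ _ p plin).
exists P; split=> [w|x Kx] /=; apply: uniq_p; first by rewrite subrr.
by rewrite linear0 subr0; left.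
Qed.

(** * Rank *)

Lemma rank_le_fin (R : realType) (k : fieldType) (V W : lmodType k)
    (m : {linear V -> W}) (C : R) :
  (rank R m <= C%:E)%E <->
  (forall (r : nat) (x : 'I_r -> V), lin_indep (fun i => m (x i)) ->
     r%:R <= C).
Proof.
split=> [mC r x mx|mC].
  rewrite -lee_fin; apply: le_trans mC; apply: ereal_sup_ubound.
  by exists r => //; exists (fun i => m (x i)); split=> // i; exists (x i).
apply: ge_ereal_sup => _ [r [y [ry yfree]] <-]; rewrite lee_fin.
have /choice[x xP] : forall i, exists z, m z = y i.
  by move=> i; have [z _ mz] := ry i; exists z.
apply: (mC r x) => l l0; apply: yfree; rewrite -[RHS]l0.
by apply: eq_bigr => i _; rewrite xP.
Qed.

Lemma rank_range_le (R : realType) (k : fieldType) (U V W : lmodType k)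
    (m : {linear U -> W}) (m' : {linear V -> W}) :
  range m `<=` range m' -> (rank R m <= rank R m')%E.
Proof.
move=> sub; apply: ereal_sup_le => _ [r [y [ry yfree]] <-].
by exists r => //; exists y; split=> // i; apply: sub.
Qed.

Lemma finite_rank_comp_rV (R : realType) (k : fieldType) (V W : lmodType k)
    (n : nat) (f : {linear 'rV[k]_n -> W}) (q : {linear V -> 'rV[k]_n}) :
  finite_rank R (f \o q).
Proof.
apply: (@le_lt_trans _ _ n%:R%:E); last exact: ltry.
apply/rank_le_fin => r x xfree; rewrite ler_nat.
pose A := \matrix_(i < r) q (x i).
suff /eqP <- : row_free A by apply: rank_leq_col.
rewrite -kermx_eq0; apply/eqP/row_matrixP => j; rewrite row0.
set u := row j _.
have uA : u *m A = 0 by apply/sub_kermxP; apply: row_sub.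
apply/rowP => i; rewrite [RHS]mxE; apply: (xfree (fun i => u 0 i)) => /=.
transitivity (f (u *m A)); last by rewrite uA linear0.
rewrite mulmx_sum_row linear_sum; apply: eq_bigr => i' _.
by rewrite linearZ rowK.
Qed.

(** * Projections onto initial segments of a basis *)

Definition lin_comb (k : fieldType) (V : lmodType k) (n : nat) (v : 'I_n -> V)
  (l : 'rV[k]_n) : V := \sum_(i < n) l 0 i *: v i.

Lemma lin_comb_linear (k : fieldType) (V : lmodType k) (n : nat)
  (v : 'I_n -> V) : linear (lin_comb k V n v).
Proof.
move=> t l l'; rewrite /lin_comb scaler_sumr -big_split; apply: eq_bigr => i _.
by rewrite !mxE scalerDl scalerA.
Qed.

HB.instance Definition _ (k : fieldType) (V : lmodType k) (n : nat)
    (v : 'I_n -> V) :=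
  GRing.isLinear.Build k 'rV[k]_n V *:%R (lin_comb k V n v)
    (lin_comb_linear k V n v).

Lemma lin_comb_delta (k : fieldType) (V : lmodType k) (n : nat) (v : 'I_n -> V)
  (i : 'I_n) : lin_comb k V n v (delta_mx 0 i) = v i.
Proof.
rewrite /lin_comb (bigD1 i) //= !mxE !eqxx scale1r big1 ?addr0// => j ji.
by rewrite mxE (negPf ji) andbF scale0r.
Qed.

Lemma lin_indep_retraction (k : fieldType) (V : lmodType k) (n : nat)
    (v : 'I_n -> V) : lin_indep v ->
  exists q : {linear V -> 'rV[k]_n}, forall l, q (lin_comb k V n v l) = l.
Proof.
move=> vfree.
have [//|t x y -> ->|l l0|q [qv _]] :=
  linear_retraction k V 'rV[k]_n (lin_comb k V n v) [set 0].
- by rewrite /= scaler0 addr0.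
- by apply/rowP => i; rewrite [RHS]mxE; apply: (vfree (fun i => l 0 i) l0).
by exists q.
Qed.

Lemma basis_projection_fix (k : fieldType) (V : lmodType k) (v : nat -> V)
    (q : forall n, {linear V -> 'rV[k]_n}) (x : V) :
    is_basis v ->
    (forall n l, q n (lin_comb k V n (fun i => v i) l) = l) ->
  \forall n \near \oo, lin_comb k V n (fun i => v i) (q n x) = x.
Proof.
move=> [_ vspan] qK; have [m [l ->]] := vspan x.
apply: filterS (nbhs_infty_ge m) => n mn.
rewrite !linear_sum; apply: eq_bigr => i _; rewrite !linearZ; congr (_ *: _).
rewrite -[v i](lin_comb_delta k V n (fun i => v i) (widen_ord mn i)).
by rewrite qK.
Qed.

(** * Limits of linear maps along an ultrafilter *)

Definition family_map (k : fieldType) (V W : lmodType k)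
  (u : nat -> {linear V -> W}) (x : V) : nat -> W := fun n => u n x.

Lemma family_map_linear (k : fieldType) (V W : lmodType k)
  (u : nat -> {linear V -> W}) : linear (family_map k V W u).
Proof. by move=> t x y; apply/funext => n; rewrite /family_map linearP. Qed.

HB.instance Definition _ (k : fieldType) (V W : lmodType k)
    (u : nat -> {linear V -> W}) :=
  GRing.isLinear.Build k V (nat -> W) *:%R (family_map k V W u)
    (family_map_linear k V W u).

(** The limit functional is a retraction of the ultrapower of [W] onto the
    diagonal copy of [W], read on sequences. *)
Lemma ultralimit_exists (k : fieldType) (W : lmodType k) (U : set_system nat) :
    ProperFilter U ->
  exists L : {linear (nat -> W) -> W}, (forall w, L (fun=> w) = w) /\
    (forall s, (\forall n \near U, s n = 0) -> L s = 0).
Proof.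
move=> FU.
have dlin : linear (fun (w : W) (_ : nat) => w) by move=> t x y; apply/funext.
pose D : {linear W -> (nat -> W)} :=
  HB.pack (fun (w : W) (_ : nat) => w) (GRing.isLinear.Build _ _ _ _ _ dlin).
have [||w /filter_ex[] //|L [LD L0]] := linear_retraction k (nat -> W) W D
    [set s : nat -> W | \forall n \near U, s n = 0].
- by apply: nearW.
- move=> t x y /= x0 y0; apply: filterS2 x0 y0 => n xn yn.
  by rewrite -[LHS]/(t *: x n + y n) xn yn scaler0 addr0.
by exists L.
Qed.

(** Finiteness of [k] enters here: an independent family of vectors [L (s i)]
    has finitely many relations to avoid, each is avoided by the [s i n] for
    almost all [n] (the ultrafilter decides, and [L] kills what vanishes almost
    everywhere), hence some index [n] avoids all of them at once. *)
Lemma ultralimit_lin_indep (k : finFieldType) (W : lmodType k)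
    (U : set_system nat) (L : {linear (nat -> W) -> W}) (r : nat)
    (s : 'I_r -> nat -> W) :
    UltraFilter U ->
    (forall s, (\forall n \near U, s n = 0) -> L s = 0) ->
    lin_indep (fun i => L (s i)) ->
  \forall n \near U, lin_indep (fun i => s i n).
Proof.
move=> FU L0 Lfree.
have : \forall n \near U, forall l : {ffun 'I_r -> k},
    l != 0 -> \sum_(i < r) l i *: s i n != 0.
  apply: filter_forall => l.
  have [lz|nz] := in_ultra_setVsetC [set n | \sum_(i < r) l i *: s i n = 0] FU.
    suff -> : l = 0 by apply: nearW => n; rewrite eqxx.
    apply/ffunP => i; rewrite ffunE; apply: (Lfree l).
    transitivity (L (\sum_(i < r) l i *: s i)).
      by rewrite linear_sum; apply: eq_bigr => j _; rewrite linearZ.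
    by apply: L0; apply: filterS lz => n /= <-; rewrite fct_sumE.
  by apply: filterS nz => n /= /eqP.
apply: filterS => n nfree l l0 i.
have := nfree (finfun l); have [/ffunP/(_ i)|_ /(_ isT)] := eqVneq (finfun l) 0.
  by rewrite !ffunE.
by under eq_bigr do rewrite ffunE; rewrite l0 eqxx.
Qed.

Lemma ultralimit_rank_le (R : realType) (k : finFieldType) (V W : lmodType k)
    (U : set_system nat) (L : {linear (nat -> W) -> W}) (m : {linear V -> W})
    (u : nat -> {linear V -> W}) (C : R) :
    UltraFilter U ->
    (forall s, (\forall n \near U, s n = 0) -> L s = 0) ->
    (forall x, m x = L (family_map k V W u x)) ->
    (forall n, (rank R (u n) <= C%:E)%E) ->
  (rank R m <= C%:E)%E.
Proof.
move=> FU L0 mL uC; apply/rank_le_fin => r x mx.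
have Lfree : lin_indep (fun i => L (family_map k V W u (x i))).
  move=> l l0; apply: mx; rewrite -[RHS]l0.
  by apply: eq_bigr => i _; rewrite mL.
have [n] := filter_ex (ultralimit_lin_indep k W U L r _ FU L0 Lfree).
by move: (uC n) => /rank_le_fin; apply.
Qed.

(** * Extension from finite rank to all linear maps *)

Theorem proposition2p7 (R : realType) (G : zmodType) (Gam : nat -> set G)
    (Gam_fg : forall n : nat, fg_subgroup (Gam n))
    (Gam_incr : forall n : nat, Gam n `<=` Gam n.+1)
    (Gam_cover : \bigcup_n Gam n = [set: G])
    (k : finFieldType) (V W : lmodType k) (v : nat -> V) (w : nat -> W)
    (v_basis : is_basis v) (w_basis : is_basis w)
    (c : R) (c_ge0 : 0 <= c) (C : R)
    (finite_rank_case : forall af : G -> {linear V -> W},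
      (forall g, finite_rank R (af g)) ->
      (forall x y : G, (rank R (af (x + y) \- af x \- af y)%R <= c%:E)%E) ->
      exists chif : G -> {linear V -> W},
        [/\ forall g, finite_rank R (chif g),
            is_hom chif
          & forall g, (rank R (af g \- chif g)%R <= C%:E)%E]) :
  forall a : G -> {linear V -> W},
    (forall x y : G, (rank R (a (x + y) \- a x \- a y)%R <= c%:E)%E) ->
    exists chi : G -> {linear V -> W},
      is_hom chi /\ forall g, (rank R (a g \- chi g)%R <= C%:E)%E.
Proof.
move=> a a_defect.
have retr n := cid (lin_indep_retraction k V n _ (v_basis.1 n)).
pose q n := projT1 (retr n); have qK n := projT2 (retr n).
pose p n : {linear V -> V} := lin_comb k V n (fun i => v i) \o q n.
have /choice[chin chinP] : forall n, exists chif : G -> {linear V -> W},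
    is_hom chif /\ forall g, (rank R ((a g \o p n) \- chif g)%R <= C%:E)%E.
  move=> n; have [g|x y|chif [_ ? ?]] :=
    finite_rank_case (fun g => a g \o p n); last by exists chif.
  - exact: (finite_rank_comp_rV R k V W n
      (a g \o lin_comb k V n (fun i => v i)) (q n)).
  - apply: le_trans (a_defect x y); apply: rank_range_le => _ [z _ <-].
    by exists (p n z).
have [U [FU ooU]] := ultraFilterLemma eventually_filter.
have [L [LD L0]] := ultralimit_exists k W U _.
pose chi g : {linear V -> W} := L \o family_map k V W (fun n => chin n g).
exists chi; split=> [x y z /=|g].
  by rewrite -linearD; congr (L _); apply/funext => n; apply: (chinP n).1.
apply: (ultralimit_rank_le R k V W U L _
  (fun n => (a g \o p n) \- chin n g)%R C FU L0) => [x|n];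
  last exact: (chinP n).2.
(* Almost all [p n] fix [x], so [L] does not see the truncation of [a g]. *)
rewrite -[X in X - _ = _]/(a g x) -{1}(LD (a g x)) /= -linearB.
apply/eqP; rewrite -subr_eq0 -linearB; apply/eqP/L0/ooU.
have := basis_projection_fix k V v q x v_basis qK.
by apply: filterS => n pnx; rewrite !fctE /family_map /= pnx subrr.
Qed.
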